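(* Let $A$ be a commutative, noetherian, reduced ring with identity and $<$ a term order. Let $I\subset A[x]=A[x_1,\ldots,x_n]$ be a homogeneous ideal and $L\subset\operatorname{Spec}(A)$ locally closed. Then the equivalence classes of the equivalence relation $\sim$ defined on $L$ by $\mathfrak{p}\sim\mathfrak{p}'$ if $\operatorname{lt}(\langle\sigma_\mathfrak{p}(I)\rangle)=\operatorname{lt}(\langle\sigma_{\mathfrak{p}'}(I)\rangle)$ are parametric with respect to $I$.
   Context: Standing setting: $A$ is a commutative, noetherian, reduced ring with identity, $\mathcal{T}$ is the set of terms (power products) in $x_1,\ldots,x_n$, and $<$ is a fixed term order on $\mathcal{T}$. Homogeneous refers to the standard grading of $A[x]$ (each $x_i$ of degree $1$, $A$ in degree $0$). For a nonzero polynomial $P$ over a commutative ring, $\operatorname{lt}(P)$ is the largest term occurring in $P$ with nonzero coefficient. For an ideal $K$ of a polynomial ring, $\operatorname{lt}(K)=\{\operatorname{lt}(P);\ P\in K\smallsetminus\{0\}\}$. For $\mathfrak{p}\in\operatorname{Spec}(A)$, $k(\mathfrak{p})=A_\mathfrak{p}/\mathfrak{p}A_\mathfrak{p}$, $\sigma_\mathfrak{p}:A[x]\to k(\mathfrak{p})[x]$ is the coefficientwise extension of $A\to k(\mathfrak{p})$, and $\langle\sigma_\mathfrak{p}(I)\rangle$ is the ideal generated by $\sigma_\mathfrak{p}(I)$. A locally closed subset $Y$ of $\operatorname{Spec}(A)$ carries the induced reduced subscheme structure $\mathcal{O}_Y$. Let $\mathfrak{a}\subset A$ be the radical ideal with $\overline{Y}=V(\mathfrak{a})$,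 identify $\operatorname{Spec}(A/\mathfrak{a})$ with $V(\mathfrak{a})$, and let $\overline{I}$ be the extension of $I$ in $(A/\mathfrak{a})[x]$. Define $\mathcal{I}_Y$ as the restriction to $Y$ of the quasi-coherent sheaf on $\operatorname{Spec}(A/\mathfrak{a})$ associated to the $A/\mathfrak{a}$-module $\overline{I}$. Then $\mathcal{I}_Y(Y)$ is regarded as an ideal of $\mathcal{O}_Y(Y)[x]$. For $g\in\mathcal{I}_Y(Y)$ and $\mathfrak{p}\in Y$, $\overline{g}^{\mathfrak{p}}\in\langle\sigma_\mathfrak{p}(I)\rangle$ denotes the image of $g$ under the coefficientwise map $\mathcal{O}_Y(Y)[x]\to k(\mathfrak{p})[x]$. Parametric: a subset $Y\subset\operatorname{Spec}(A)$ is parametric (with respect to $I$ and $<$) if it is locally closed and there is a finite subset $G\subset\mathcal{I}_Y(Y)$ such that (1) $\overline{G}^{\mathfrak{p}}=\{\overline{g}^{\mathfrak{p}};\ g\in G\}$ is the reduced Gröbner basis of $\langle\sigma_\mathfrak{p}(I)\rangle$ for every $\mathfrak{p}\in Y$, and (2) for each $g\in G$ the function $\mathfrak{p}\mapsto\operatorname{lt}(\overline{g}^{\mathfrak{p}})$ is constant on $Y$. *)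

(* Defs.v *)
From HB Require Import structures.
From mathcomp Require Import all_boot all_order all_algebra generic_quotient.
From mathcomp Require Import boolp classical_sets cardinality.
From mathcomp Require Import topology_structure.
From mathcomp Require Import mpoly.
From mathcomp Require Import ring.

Set Implicit Arguments.
Unset Strict Implicit.
Unset Printing Implicit Defensive.

Import GRing.Theory.
Local Open Scope ring_scope.
Local Open Scope classical_set_scope.
Local Open Scope quotient_scope.

(* MathComp's [idealr] only covers proper decidable ideals; here an ideal may
   be the whole ring. *)
Definition is_ideal (R : comNzRingType) (J : set R) : Prop :=
  [/\ J 0, (forall x y, J x -> J y -> J (x + y)) &
      forall a x, J x -> J (a * x)].

Definition ideal_gen (R : comNzRingType) (S : set R) : set R :=
  smallest (@is_ideal R) S.

Definition noetherian (R : comNzRingType) : Prop :=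
  forall J : set R, is_ideal J ->
  exists2 S : set R, finite_set S & J = ideal_gen S.

Definition reduced (R : comNzRingType) : Prop :=
  forall (x : R) (k : nat), x ^+ k = 0 -> x = 0.

Lemma is_idealN (R : comNzRingType) (J : set R) x :
  is_ideal J -> J x -> J (- x).
Proof. by move=> [_ _ JM] Jx; rewrite -mulN1r; exact: JM. Qed.

Lemma ideal_gen_ideal (R : comNzRingType) (S : set R) : is_ideal (ideal_gen S).
Proof.
split=> [J [[]//]|x y Sx Sy J JS|a x Sx J JS].
  by case: (JS) => -[_ JD _] _; apply: JD; [exact: Sx|exact: Sy].
by case: (JS) => -[_ _ JM] _; apply: JM; exact: Sx.
Qed.

Definition is_prime (A : comNzRingType) (P : set A) : Prop :=
  [/\ is_ideal P, ~ P 1 & forall a b, P (a * b) -> P a \/ P b].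

Record spec (A : comNzRingType) := Spec {
  pideal : set A;
  pidealP : is_prime pideal }.

Section Spectrum.
Context {A : comNzRingType}.
Implicit Types (p q : spec A) (E : set A) (Y : set (spec A)).

Definition zeros E : set (spec A) := [set p | E `<=` pideal p].

Definition zariski_open (U : set (spec A)) : Prop :=
  exists E, U = ~` zeros E.

Lemma zariski_openT : zariski_open [set: spec A].
Proof.
exists setT; apply/seteqP; split=> // p _ /(_ 1 I).
by case: (pidealP p).
Qed.

Lemma zariski_openI (U V : set (spec A)) :
  zariski_open U -> zariski_open V -> zariski_open (U `&` V).
Proof.
move=> [E ->] [F ->]; exists [set a * b | a in E & b in F].
apply/seteqP; split=> p.
  move=> [/existsNP[a /not_implyP[Ea pa]] /existsNP[b /not_implyP[Fb pb]]] EFp.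
  case: (pidealP p) => _ _ /(_ a b) [|//|//].
  by apply: EFp; exists a => //; exists b.
case: (pidealP p) => -[_ _ pM] _ _ EFp; split=> Zp; apply: EFp.
  by move=> _ [a /Zp pa [b _ <-]]; rewrite mulrC; exact: pM.
by move=> _ [a _ [b /Zp pb <-]]; exact: pM.
Qed.

Lemma zariski_open_bigcup (J : Type) (U : J -> set (spec A)) :
  (forall j, zariski_open (U j)) -> zariski_open (\bigcup_j U j).
Proof.
move=> /choice[E UE]; exists (\bigcup_j E j).
apply/seteqP; split=> p.
  by move=> [j _]; rewrite UE => Zp Ep; apply: Zp => a Ea; apply: Ep; exists j.
move=> /existsNP[a /not_implyP[[j _ Eja] pa]].
by exists j => //; rewrite UE => /(_ _ Eja).
Qed.

End Spectrum.

HB.instance Definition _ (A : comNzRingType) := gen_eqMixin (spec A).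
HB.instance Definition _ (A : comNzRingType) := gen_choiceMixin (spec A).
HB.instance Definition _ (A : comNzRingType) :=
  isOpenTopological.Build (spec A)
    zariski_openT zariski_openI zariski_open_bigcup.

Definition locally_closed (T : topologicalType) (Y : set T) : Prop :=
  exists U Z : set T, [/\ open U, closed Z & Y = U `&` Z].

Definition vanishing (A : comNzRingType) (Y : set (spec A)) : set A :=
  \bigcap_(p in Y) pideal p.

Section Vanishing.
Context {A : comNzRingType}.
Implicit Types (Y : set (spec A)).

Lemma vanishing_ideal Y : is_ideal (vanishing Y).
Proof.
split=> [p _|x y Yx Yy p Yp|a x Yx p Yp]; case: (pidealP p) => -[p0 pD pM] _ _.
- exact: p0.
- by apply: pD; [exact: Yx|exact: Yy].
- by apply: pM; exact: Yx.
Qed.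

Lemma vanishing_radical Y (x : A) k : vanishing Y (x ^+ k) -> vanishing Y x.
Proof.
move=> Yx p Yp; move: (Yx p Yp) => {Yx}; case: (pidealP p) => _ p1 pM.
by elim: k => [/p1//|k IH]; rewrite exprS => /pM[].
Qed.

Lemma closure_vanishing Y : closure Y = zeros (vanishing Y).
Proof.
apply/seteqP; split=> p.
  move=> clp a Ya; apply: contrapT => pa.
  have : nbhs p (~` zeros [set a]).
    by apply: open_nbhs_nbhs; split; [exists [set a]|move=> /(_ a erefl)].
  by move=> /clp[q [Yq Zq]]; apply: Zq => _ ->; exact: Ya.
move=> Yp B; rewrite nbhsE => -[U [[E UE] Up] UB].
apply: contrapT => YB; move: Up; rewrite UE; apply=> a Ea.
apply: Yp => q Yq; apply: contrapT => qa; apply: YB; exists q; split=> //.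
by apply: UB; rewrite UE => /(_ a Ea).
Qed.

End Vanishing.

(* [loc d] is the local ring (A/a)_p for a prime p and an ideal a contained
   in p: the fractions r/s with s not in p, where r/s = r'/s' when
   u (r s' - r' s) lies in a for some u not in p. *)
Record locdata (A : comNzRingType) := LocData {
  loc_ideal : set A;
  loc_prime : spec A;
  loc_idealP : is_ideal loc_ideal;
  loc_ideal_sub : loc_ideal `<=` pideal loc_prime }.

Section Localization.
Context {A : comNzRingType}.

Definition denom (p : spec A) := {s : A | ~~ `[< pideal p s >]}.

Lemma denomP p (s : denom p) : ~ pideal p (val s).
Proof. by apply/asboolPn; exact: (valP s). Qed.

Lemma denom1_subproof (p : spec A) : ~~ `[< pideal p 1 >].
Proof. by apply/asboolPn; case: (pidealP p). Qed.

Lemma denomM_subproof (p : spec A) (s t : denom p) : ~~ `[< pideal p (val s * val t) >].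
Proof.
by apply/asboolPn; case: (pidealP p) => _ _ pM /pM[] /denomP.
Qed.

Definition denom1 (p : spec A) : denom p := Sub 1 (denom1_subproof p).
Definition denomM (p : spec A) (s t : denom p) : denom p :=
  Sub (val s * val t) (denomM_subproof s t).

Definition preloc (p : spec A) := (A * denom p)%type.

Context (d : locdata A).
Notation a := (loc_ideal d).
Notation p := (loc_prime d).

Definition loc_eq (x y : preloc p) : bool :=
  `[< exists2 u, ~ pideal p u & a (u * (x.1 * val y.2 - y.1 * val x.2)) >].

Lemma loc_eq_refl : reflexive loc_eq.
Proof.
move=> x; apply/asboolP; exists 1; first by case: (pidealP p).
by rewrite subrr mulr0; case: (loc_idealP d).
Qed.

Lemma loc_eq_sym : ssrbool.symmetric loc_eq.
Proof.
move=> x y; apply/asboolP/asboolP => -[u pu axy]; exists u => //;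
by rewrite -opprB mulrN; apply: is_idealN; first exact: loc_idealP.
Qed.

Lemma loc_eq_trans : transitive loc_eq.
Proof.
move=> y x z /asboolP[u pu axy] /asboolP[v pv ayz]; apply/asboolP.
exists (u * v * val y.2).
  case: (pidealP p) => _ _ pM /pM[/pM[]//|]; exact: denomP.
have [_ aD aM] := loc_idealP d.
have -> : u * v * val y.2 * (x.1 * val z.2 - z.1 * val x.2) =
  v * val z.2 * (u * (x.1 * val y.2 - y.1 * val x.2)) +
  u * val x.2 * (v * (y.1 * val z.2 - z.1 * val y.2)) by ring.
by apply: aD; apply: aM.
Qed.

Canonical loc_equiv := EquivRel loc_eq loc_eq_refl loc_eq_sym loc_eq_trans.

Definition loc := {eq_quot loc_eq}.
HB.instance Definition _ : EqQuotient _ loc_eq loc := EqQuotient.on loc.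
HB.instance Definition _ := Choice.on loc.

Lemma loc_piP (x y : preloc p) : reflect
  (exists2 u, ~ pideal p u & a (u * (x.1 * val y.2 - y.1 * val x.2)))
  (\pi_loc x == \pi_loc y).
Proof. by rewrite eqmodE; exact: asboolP. Qed.

Lemma loc_pi_eq (x y : preloc p) :
  x.1 * val y.2 = y.1 * val x.2 -> \pi_loc x = \pi_loc y.
Proof.
move=> xy; apply/eqP/loc_piP; exists 1; first by case: (pidealP p).
by rewrite xy subrr mulr0; case: (loc_idealP d).
Qed.

Lemma loc_reprP (x : preloc p) :
  exists2 u, ~ pideal p u &
    a (u * (x.1 * val (repr (\pi_loc x)).2 - (repr (\pi_loc x)).1 * val x.2)).
Proof. by apply/loc_piP; rewrite reprK. Qed.

Definition loc_add (x y : loc) : loc :=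
  let: (r, s) := repr x in let: (r', s') := repr y in
  \pi_loc (r * val s' + r' * val s, denomM s s').
Definition loc_opp (x : loc) : loc :=
  let: (r, s) := repr x in \pi_loc (- r, s).
Definition loc_mul (x y : loc) : loc :=
  let: (r, s) := repr x in let: (r', s') := repr y in
  \pi_loc (r * r', denomM s s').

Lemma loc_add_pi (x y : preloc p) : loc_add (\pi_loc x) (\pi_loc y) =
  \pi_loc (x.1 * val y.2 + y.1 * val x.2, denomM x.2 y.2).
Proof.
rewrite /loc_add; case: (loc_reprP x) (loc_reprP y) => u pu + [v pv].
case: (repr (\pi_loc x)) (repr (\pi_loc y)) => [r s] [r' s'] /= ax ay.
apply/eqP; rewrite eq_sym; apply/loc_piP; exists (u * v) => /=.
  by case: (pidealP p) => _ _ pM /pM[].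
have [_ aD aM] := loc_idealP d.
set w := (X in a X).
have -> : w = v * val y.2 * val s' * (u * (x.1 * val s - r * val x.2)) +
  u * val x.2 * val s * (v * (y.1 * val s' - r' * val y.2)).
  by rewrite /w /=; ring.
by apply: aD; apply: aM.
Qed.

Lemma loc_opp_pi (x : preloc p) : loc_opp (\pi_loc x) = \pi_loc (- x.1, x.2).
Proof.
rewrite /loc_opp; case: (loc_reprP x) => u pu.
case: (repr (\pi_loc x)) => [r s] /= ax.
apply/eqP/loc_piP; exists u => //=; set w := (X in a X).
by have -> : w = u * (x.1 * val s - r * val x.2) by rewrite /w /=; ring.
Qed.

Lemma loc_mul_pi (x y : preloc p) : loc_mul (\pi_loc x) (\pi_loc y) =
  \pi_loc (x.1 * y.1, denomM x.2 y.2).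
Proof.
rewrite /loc_mul; case: (loc_reprP x) (loc_reprP y) => u pu + [v pv].
case: (repr (\pi_loc x)) (repr (\pi_loc y)) => [r s] [r' s'] /= ax ay.
apply/eqP; rewrite eq_sym; apply/loc_piP; exists (u * v) => /=.
  by case: (pidealP p) => _ _ pM /pM[].
have [_ aD aM] := loc_idealP d.
set w := (X in a X).
have -> : w = v * y.1 * val s' * (u * (x.1 * val s - r * val x.2)) +
  u * r * val x.2 * (v * (y.1 * val s' - r' * val y.2)).
  by rewrite /w /=; ring.
by apply: aD; apply: aM.
Qed.

Definition loc_of (r : A) : loc := \pi_loc (r, denom1 p).

Lemma loc_addA : associative loc_add.
Proof.
elim/quotW=> x; elim/quotW=> y; elim/quotW=> z.
by rewrite !loc_add_pi; apply: loc_pi_eq => /=; ring.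
Qed.

Lemma loc_addC : commutative loc_add.
Proof.
elim/quotW=> x; elim/quotW=> y.
by rewrite !loc_add_pi; apply: loc_pi_eq => /=; ring.
Qed.

Lemma loc_add0 : left_id (loc_of 0) loc_add.
Proof.
by elim/quotW=> x; rewrite !loc_add_pi; apply: loc_pi_eq => /=; ring.
Qed.

Lemma loc_addN : left_inverse (loc_of 0) loc_opp loc_add.
Proof.
elim/quotW=> x.
by rewrite loc_opp_pi loc_add_pi; apply: loc_pi_eq => /=; ring.
Qed.

HB.instance Definition _ :=
  GRing.isZmodule.Build loc loc_addA loc_addC loc_add0 loc_addN.

Lemma loc_mulA : associative loc_mul.
Proof.
elim/quotW=> x; elim/quotW=> y; elim/quotW=> z.
by rewrite !loc_mul_pi; apply: loc_pi_eq => /=; ring.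
Qed.

Lemma loc_mulC : commutative loc_mul.
Proof.
elim/quotW=> x; elim/quotW=> y.
by rewrite !loc_mul_pi; apply: loc_pi_eq => /=; ring.
Qed.

Lemma loc_mul1 : left_id (loc_of 1) loc_mul.
Proof.
by elim/quotW=> x; rewrite !loc_mul_pi; apply: loc_pi_eq => /=; ring.
Qed.

Lemma loc_mulD : left_distributive loc_mul loc_add.
Proof.
elim/quotW=> x; elim/quotW=> y; elim/quotW=> z.
by rewrite !(loc_mul_pi, loc_add_pi); apply: loc_pi_eq => /=; ring.
Qed.

Lemma loc_1neq0 : loc_of 1 != loc_of 0.
Proof.
apply/negP => /loc_piP[u pu /=]; rewrite mul0r subr0 !mulr1.
by move=> /loc_ideal_sub.
Qed.

HB.instance Definition _ := GRing.Zmodule_isComNzRing.Build loc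
  loc_mulA loc_mulC loc_mul1 loc_mulD loc_1neq0.

Lemma loc_of_zmod_morphism : zmod_morphism loc_of.
Proof.
move=> x y.
have -> : loc_of x - loc_of y = loc_add (loc_of x) (loc_opp (loc_of y)) by [].
by rewrite loc_opp_pi loc_add_pi; apply: loc_pi_eq => /=; ring.
Qed.

Lemma loc_of_monoid_morphism : monoid_morphism loc_of.
Proof.
split=> // x y.
have -> : loc_of x * loc_of y = loc_mul (loc_of x) (loc_of y) by [].
by rewrite loc_mul_pi; apply: loc_pi_eq => /=; ring.
Qed.

HB.instance Definition _ :=
  GRing.isZmodMorphism.Build A loc loc_of loc_of_zmod_morphism.
HB.instance Definition _ :=
  GRing.isMonoidMorphism.Build A loc loc_of loc_of_monoid_morphism.

(* The fraction r/s; junk (namely r/1) if s is in p. *)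
Definition loc_frac (r s : A) : loc := \pi_loc (r, insubd (denom1 p) s).

Lemma loc_frac_mul (r s : A) :
  ~ pideal p s -> loc_of s * loc_frac r s = loc_of r.
Proof.
move=> /asboolPn ps.
have -> : loc_of s * loc_frac r s = loc_mul (loc_of s) (loc_frac r s) by [].
rewrite loc_mul_pi; apply: loc_pi_eq => /=.
by rewrite val_insubd ps /=; ring.
Qed.

End Localization.

Section Residue.
Context {A : comNzRingType}.

Lemma pideal_ideal (p : spec A) : is_ideal (pideal p).
Proof. by case: (pidealP p). Qed.

(* k(p) = A_p / p A_p, realized as (A/p)_p since localization commutes with
   quotients. *)
Definition residue (p : spec A) :=
  loc (LocData (pideal_ideal p) (@subset_refl _ (pideal p))).
HB.instance Definition _ p := GRing.ComNzRing.on (residue p).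

Definition to_residue (p : spec A) : A -> residue p := @loc_of A _.
HB.instance Definition _ p := GRing.RMorphism.on (@to_residue p).

Definition residue_inv (p : spec A) (x : residue p) : residue p :=
  if x == 0 then 0 else loc_frac _ (val (repr x).2) (repr x).1.

Lemma residue_mulV (p : spec A) (x : residue p) :
  x != 0 -> residue_inv x * x = 1.
Proof.
move=> x0; rewrite /residue_inv (negPf x0).
move: x0; rewrite -{1 4}[x]reprK.
case: (repr x) => r s /= x0.
have pr : ~ pideal p r.
  move=> pr; move/negP: x0; apply; apply/loc_piP; exists 1 => /=.
    by case: (pidealP p).
  by rewrite mul0r subr0 mulr1 mul1r.
move/asboolPn: (pr) => pr'.
rewrite [LHS]loc_mul_pi; apply: loc_pi_eq => /=.
by rewrite val_insubd pr' /=; ring.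
Qed.

Lemma residue_inv0 (p : spec A) : residue_inv (0 : residue p) = 0.
Proof. by rewrite /residue_inv eqxx. Qed.

HB.instance Definition _ p := GRing.ComNzRing_isField.Build (residue p)
  (@residue_mulV p) (@residue_inv0 p).

Context (d : locdata A).

Definition loc_residue (x : loc d) : residue (loc_prime d) :=
  \pi_(residue (loc_prime d)) (repr x : preloc (loc_prime d)).

Lemma loc_residue_pi (x : preloc (loc_prime d)) :
  loc_residue (\pi_(loc d) x) = \pi_(residue (loc_prime d)) x.
Proof.
rewrite /loc_residue; apply/eqP; rewrite eq_sym; apply/loc_piP.
case: (loc_reprP x) => u pu /loc_ideal_sub ax.
by exists u.
Qed.

Lemma loc_residue_zmod_morphism : zmod_morphism loc_residue.
Proof.
elim/quotW=> x; elim/quotW=> y.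
have -> : \pi_(loc d) x - \pi_(loc d) y =
  loc_add (\pi_(loc d) x) (loc_opp (\pi_(loc d) y)) by [].
rewrite loc_opp_pi loc_add_pi !loc_residue_pi.
by rewrite [in RHS]/GRing.add /= [in RHS]/GRing.opp /= loc_opp_pi loc_add_pi.
Qed.

Lemma loc_residue_monoid_morphism : monoid_morphism loc_residue.
Proof.
split; first exact: loc_residue_pi.
elim/quotW=> x; elim/quotW=> y.
have -> : \pi_(loc d) x * \pi_(loc d) y =
  loc_mul (\pi_(loc d) x) (\pi_(loc d) y) by [].
rewrite loc_mul_pi !loc_residue_pi.
by rewrite [in RHS]/GRing.mul /= loc_mul_pi.
Qed.

HB.instance Definition _ := GRing.isZmodMorphism.Build (loc d)
  (residue (loc_prime d)) loc_residue loc_residue_zmod_morphism.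
HB.instance Definition _ := GRing.isMonoidMorphism.Build (loc d)
  (residue (loc_prime d)) loc_residue loc_residue_monoid_morphism.

End Residue.

Section Terms.
Context {n : nat}.
Implicit Types (le : rel 'X_{1..n}).

Definition term_order le : Prop :=
  [/\ total le, antisymmetric le, transitive le,
      (forall m, le 0%MM m) &
      forall m m1 m2, le m1 m2 -> le (m + m1)%MM (m + m2)%MM].

(* The default value for P = 0 is the term 1. *)
Definition lterm le (R : comNzRingType) (P : {mpoly R[n]}) : 'X_{1..n} :=
  \big[(fun m1 m2 => if le m1 m2 then m2 else m1)/0%MM]_(m <- msupp P) m.

Lemma ltermP le (R : comNzRingType) (P : {mpoly R[n]}) :
  term_order le -> P != 0 ->
  lterm le P \in msupp P /\ {in msupp P, forall m, le m (lterm le P)}.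
Proof.
move=> [tot anti tr le0 _]; rewrite -msupp_eq0 /lterm.
elim: (msupp P) => [//|m s IH] _; rewrite big_cons.
case: s IH => [_|m' s /(_ isT)].
  rewrite big_nil; set t := (if _ then _ else _).
  have -> : t = m.
    by rewrite /t; case: ifP => // m0; apply: anti; rewrite m0 le0.
  rewrite inE eqxx; split=> // x; rewrite inE => /eqP->.
  by have := tot m m; rewrite orbb.
set t := bigop _ _ _ => -[ts tmax]; case: ifPn => [mt|/negPf mt].
  split=> [|x]; first by rewrite inE ts orbT.
  by rewrite inE => /orP[/eqP->//|/tmax].
have tm : le t m by have := tot m t; rewrite mt.
split=> [|x]; first by rewrite inE eqxx.
rewrite inE => /orP[/eqP->|/tmax /tr]; last exact.
by have := tot m m; rewrite orbb.
Qed.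

Definition lterms le (R : comNzRingType) (S : set {mpoly R[n]}) :
    set 'X_{1..n} :=
  [set lterm le P | P in S `\ 0].

Definition lterm_ideal le (R : comNzRingType) (S : set {mpoly R[n]}) :
    set {mpoly R[n]} :=
  ideal_gen [set 'X_[t] | t in lterms le S].

Definition groebner_basis le (k : fieldType) (K G : set {mpoly k[n]}) : Prop :=
  [/\ finite_set G, G `<=` K & lterm_ideal le G = lterm_ideal le K].

Definition reduced_groebner_basis le (k : fieldType)
    (K G : set {mpoly k[n]}) : Prop :=
  [/\ groebner_basis le K G,
      (forall g, G g -> g@_(lterm le g) = 1) &
      forall g m, G g -> m \in msupp g -> ~ lterm_ideal le (G `\ g) 'X_[m]].

Definition homogeneous (R : comNzRingType) (I : set {mpoly R[n]}) : Prop :=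
  forall (f : {mpoly R[n]}) (d : nat), I f -> I (pihomog mdeg d f).

End Terms.

Definition fiber_ideal (A : comNzRingType) (n : nat) (I : set {mpoly A[n]})
    (p : spec A) : set {mpoly (residue p)[n]} :=
  ideal_gen [set map_mpoly (to_residue p) f | f in I].
Arguments fiber_ideal {A n} I p.

Section Parametric.
Context {A : comNzRingType} {n : nat}.
Implicit Types (I : set {mpoly A[n]}) (Y : set (spec A)).

Definition lt_equiv (le : rel 'X_{1..n}) I (p q : spec A) : Prop :=
  lterms le (fiber_ideal I p) = lterms le (fiber_ideal I q).

Lemma vanishing_sub Y (p : Y) : vanishing Y `<=` pideal (val p).
Proof. by move=> x; apply; exact: set_valP. Qed.

(* The local ring at p of the reduced subscheme Y. The ideal [vanishing Y] is
   the radical ideal a with closure Y = V(a). *)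
Definition stalk Y (p : Y) :=
  loc (LocData (vanishing_ideal Y) (vanishing_sub p)).
HB.instance Definition _ Y (p : Y) := GRing.ComNzRing.on (stalk p).

(* The stalk at p of the sheaf attached to the extension of I in (A/a)[x] is a
   submodule of (stalk p)[x], localization being exact; its sections over Y are
   the families of germs in the stalks that are locally of the form f/s, with f
   in the extension of I and s in A/a. *)
Definition ideal_section I Y (g : forall p : Y, {mpoly (stalk p)[n]}) : Prop :=
  forall p : Y, exists U : set (spec A), [/\ open U, U (val p) &
    exists2 f, I f & exists s : A, forall q : Y, U (val q) ->
      ~ pideal (val q) s /\
      g q = loc_frac _ 1 s *: map_mpoly (@loc_of A _ : A -> stalk q) f].

Definition section_at Y (g : forall p : Y, {mpoly (stalk p)[n]}) (p : Y) :
    {mpoly (residue (val p))[n]} :=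
  map_mpoly (@loc_residue A _ : stalk p -> residue (val p)) (g p).

Definition parametric (le : rel 'X_{1..n}) I Y : Prop :=
  locally_closed Y /\
  exists G : set (forall p : Y, {mpoly (stalk p)[n]}),
  [/\ finite_set G, G `<=` @ideal_section I Y,
      (forall p : Y, reduced_groebner_basis le (fiber_ideal I (val p))
         [set section_at g p | g in G]) &
      forall g, G g -> forall p q : Y,
         lterm le (section_at g p) = lterm le (section_at g q)].

End Parametric.

Definition eq_classes (T : Type) (L : set T) (R : T -> T -> Prop) :
    set (set T) :=
  [set [set q | L q /\ R p q] | p in L].

(* Main.v *)
Require Import Defs.
From mathcomp Require Import all_boot all_order all_algebra generic_quotient.
From mathcomp Require Import boolp classical_sets cardinality.
From mathcomp Require Import topology_structure mpoly.
From mathcomp Require Import ring.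

(** Write [T] for the common set of leading terms of the fibre ideals at the
    points of the class [Y]. Everything reduces to linear algebra in one degree
    at a time, because [I] is homogeneous.

    Fix a prime [p] and a finite set [S] of leading terms, of one degree, of the
    fibre ideal at [p]. The fibre ideal is spanned by images of elements of [I]
    ([fiber_ideal_lift], [lterms_lift]), so Gaussian elimination over [A]
    ([diagonal_family]) yields elements of [I] whose coefficients on [S] form a
    diagonal matrix with entry outside [p]. Taking for [S] all of [T] in the
    degree of [t], one gets a homogeneous [f] in [I] with no term of [T] except
    [t], and with coefficient at [t] outside [p]: a numerator for [t]
    ([reduced_numerator_exists]). At every point [q] of [Y] where that
    coefficient does not vanish, the image of [f] is nonzero with a leading term
    in [T], which can only be [t]. Divided by its coefficient at [t] it is then
    the element of the reduced Groebner basis at [q] with leading term [t], for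
    each minimal generator [t] of [T]; there are finitely many of these by
    Dickson's lemma ([finite_minimal_terms]). An element of [I] with no term in
    [T] vanishes at all points of [Y] ([vanishing_coeff]); applied to cross
    differences this shows that the fractions given by different numerators
    coincide as functions on the reduced scheme [Y], so they glue to sections.

    It remains to see that [Y] is locally closed. The conditions on the leading
    terms in all degrees are infinitely many, but those that force [T] to be
    contained in the initial ideal involve only the finitely many numerators of
    the minimal terms, which keep their leading terms on an open part of the
    closure of [Y] ([reduced_numerator_closure]). The reverse inclusion is
    automatic on the closure: an additional leading term there would produce, by
    elimination again, an element of [I] with no term in [T] that is nonzero at
    points of [Y] ([lterms_closure_sub]). Hence [Y] is the intersection of an
    open set with its closure. *)

Set Implicit Arguments.
Unset Strict Implicit.
Unset Printing Implicit Defensive.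

Import GRing.Theory.
Local Open Scope ring_scope.
Local Open Scope classical_set_scope.

(** * Ideals and homogeneous components *)

Section Ideals.
Context {R : comNzRingType} (J : set R).
Hypothesis idJ : is_ideal J.

Lemma is_idealB x y : J x -> J y -> J (x - y).
Proof.
by move=> Jx Jy; case: (idJ) => _ JD _; apply: JD (is_idealN idJ Jy).
Qed.

Lemma is_ideal_sum (T : eqType) (s : seq T) (F : T -> R) :
  {in s, forall t, J (F t)} -> J (\sum_(t <- s) F t).
Proof.
case: (idJ) => J0 JD _ JF; rewrite big_seq.
by elim/big_rec: _ => // t x st; apply: JD; apply: JF.
Qed.

End Ideals.

Lemma scalerMM n (R : comNzRingType) (a b : R) (x y : {mpoly R[n]}) :
  (a * b) *: (x * y) = (a *: x) * (b *: y).
Proof. by rewrite -scalerAl -scalerAr scalerA. Qed.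

Lemma mcoeff_pihomog n (R : comNzRingType) (f : {mpoly R[n]}) d m :
  (pihomog mdeg d f)@_m = if mdeg m == d then f@_m else 0.
Proof.
rewrite pihomogE raddf_sum /=.
under eq_bigr do rewrite mcoeffZ mcoeffX.
case: ifP => md.
  case: (boolP (m \in msupp f)) => mf.
    rewrite (big_rem m) //= md eqxx mulr1 big1_seq ?addr0 // => m' /andP[_].
    rewrite mem_rem_uniq ?msupp_uniq // inE => /andP[/negPf-> _].
    by rewrite mulr0.
  rewrite (memN_msupp_eq0 mf) big1_seq // => m' /andP[_].
  by case: eqP => [->|]; [rewrite (negPf mf)|rewrite mulr0].
rewrite big1 // => m' /eqP m'd; case: eqP => [e|]; last by rewrite mulr0.
by rewrite -m'd e eqxx in md.
Qed.

(** * Primes, residue fields and fibre ideals *)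

Section Residues.
Context {A : comNzRingType}.
Implicit Types (p q : spec A) (Y : set (spec A)).

Lemma pideal_mulN p a b : ~ pideal p a -> ~ pideal p b -> ~ pideal p (a * b).
Proof. by move=> pa pb; case: (pidealP p) => _ _ pM /pM[]. Qed.

Lemma open_nonvanishing (s : A) : open [set p : spec A | ~ pideal p s].
Proof.
exists [set s]; apply/seteqP; split=> p /= ps; first by move=> /(_ s erefl).
by move=> ps'; apply: ps => _ ->.
Qed.

Lemma loc_of_eq0 (d : locdata A) a :
  loc_ideal d a -> loc_of d a = 0.
Proof.
move=> da; apply/eqP/loc_piP; exists 1; first by case: (pidealP (loc_prime d)).
by rewrite /= mul0r subr0 mulr1 mul1r.
Qed.

Lemma loc_residue_of (d : locdata A) a :
  loc_residue (loc_of d a) = to_residue (loc_prime d) a.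
Proof. by rewrite /to_residue /loc_of loc_residue_pi. Qed.

Lemma to_residue_eq0 p a : (to_residue p a == 0) = `[< pideal p a >].
Proof.
apply/eqP/asboolP => [/eqP/loc_piP[u pu]|pa]; last exact: loc_of_eq0.
by rewrite /= mul0r subr0 mulr1; case: (pidealP p) => _ _ pM /pM[].
Qed.

Lemma residue_frac p (x : residue p) :
  exists u r, ~ pideal p u /\ to_residue p u * x = to_residue p r.
Proof.
elim/quotW: x => -[r s]; exists (val s), r; split; first exact: denomP.
rewrite [LHS]loc_mul_pi; apply: loc_pi_eq => /=; ring.
Qed.

(** A polynomial over the residue field has finitely many coefficients, so their
    denominators clear simultaneously. *)
Lemma mpoly_residue_frac n p (w : {mpoly (residue p)[n]}) :
  exists u f, ~ pideal p u /\ to_residue p u *: w = map_mpoly (to_residue p) f.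
Proof.
elim/mpolyind: w => [|c m w _ _ [v [f [pv vf]]]].
  by exists 1, 0; rewrite scaler0 raddf0; split=> //; case: (pidealP p).
have [u [r [pu ur]]] := residue_frac c.
exists (u * v), ((v * r) *: 'X_[m] + u *: f); split; first exact: pideal_mulN.
rewrite rmorphD /= !map_mpolyZ /= map_mpolyX -vf scalerDr !scalerA !rmorphM /=.
by rewrite -ur; congr (_ *: _ + _); ring.
Qed.

(** Up to a nonzero scalar, the fibre ideal contains nothing but images of
    elements of [I]; this is what lets every argument about fibres be run with
    polynomials over [A] and their coefficients modulo [p]. *)
Lemma fiber_ideal_lift n (I : set {mpoly A[n]}) p w :
  is_ideal I -> fiber_ideal I p w ->
  exists u f, [/\ ~ pideal p u, I f &
    to_residue p u *: w = map_mpoly (to_residue p) f].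
Proof.
move=> [I0 ID IM].
apply: (_ : ideal_gen _ `<=` [set w | exists u f, [/\ ~ pideal p u, I f &
  to_residue p u *: w = map_mpoly (to_residue p) f]]).
apply: smallest_sub; last first.
  move=> _ [f If <-]; exists 1, f; split=> //; first by case: (pidealP p).
  by rewrite rmorph1 scale1r.
split.
- by exists 1, 0; rewrite scaler0 raddf0; split=> //; case: (pidealP p).
- move=> x y [u [f [pu If uf]]] [v [g [pv Ig vg]]].
  exists (u * v), (v *: f + u *: g); split; first exact: pideal_mulN.
    by rewrite -!mul_mpolyC; apply: ID; apply: IM.
  rewrite rmorphD /= !map_mpolyZ -uf -vg !scalerA rmorphM scalerDr /=.
  by congr (_ *: _ + _); ring.
- move=> a x [u [f [pu If uf]]].
  have [v [g [pv vg]]] := mpoly_residue_frac a.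
  exists (v * u), (g * f); split; [exact: pideal_mulN|exact: IM|].
  by rewrite !rmorphM /= -uf -vg scalerMM.
Qed.

Lemma fiber_ideal_map n (I : set {mpoly A[n]}) p f :
  I f -> fiber_ideal I p (map_mpoly (to_residue p) f).
Proof. by move=> If J [_ JS]; apply: JS; exists f. Qed.

End Residues.

(** * Dickson's lemma *)

Section Dickson.
Context {n : nat}.
Implicit Types (m t : 'X_{1..n}) (T : set 'X_{1..n}).

Lemma nondecreasing_subsequence (u : nat -> nat) : exists phi : nat -> nat,
  {homo phi : i j / (i < j)%N} /\ {homo u \o phi : i j / (i <= j)%N}.
Proof.
have /choice[k kP] N : exists k,
    (N <= k)%N /\ forall j, (N <= j)%N -> (u k <= u j)%N.
  have exv : exists v, `[< exists2 k, (N <= k)%N & u k = v >].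
    by exists (u N); apply/asboolP; exists N.
  case: (ex_minnP exv) => v /asboolP[k Nk <-] vmin; exists k; split=> // j Nj.
  by apply: vmin; apply/asboolP; exists j.
pose phi := fix phi i := if i is j.+1 then k (phi j).+1 else k 0%N.
have phiS i : (phi i < phi i.+1)%N by case: (kP (phi i).+1).
exists phi; split.
  exact: (homo_ltn (r := fun a b => (a < b)%N) ltn_trans phiS).
apply: (homo_leq (r := fun a b => (a <= b)%N) leqnn leq_trans) => i /=.
have phiP j : exists2 N, phi j = k N & (N <= phi j)%N.
  case: j => [|j]; by [exists 0%N|exists (phi j).+1].
have [N eN Ni] := phiP i; rewrite {1}eN; have [_] := kP N; apply.
exact: leq_trans Ni (ltnW (phiS i)).
Qed.

Lemma coordinatewise_subsequence (u : nat -> 'X_{1..n}) (s : seq 'I_n) :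
  exists phi : nat -> nat, {homo phi : a b / (a < b)%N} /\
    forall i, i \in s -> {homo (fun a => u (phi a) i) : a b / (a <= b)%N}.
Proof.
elim: s => [|i s [phi [phi_lt phi_s]]]; first by exists id; split=> // i.
have [psi [psi_lt psi_u]] := nondecreasing_subsequence (fun a => u (phi a) i).
exists (phi \o psi); split=> [a b ab|i']; first by apply: phi_lt; apply: psi_lt.
rewrite inE => /orP[/eqP->|/phi_s hs a b ab]; first exact: psi_u.
exact: hs (ltnW_homo psi_lt ab).
Qed.

Definition minimal_terms T : set 'X_{1..n} :=
  [set t | T t /\ forall m, T m -> (m <= t)%MM -> m = t].

(** Dickson's lemma: in an infinite sequence of terms, a subsequence that is
    nondecreasing in every exponent exhibits two comparable ones. *)
Lemma finite_minimal_terms T : finite_set (minimal_terms T).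
Proof.
apply: contrapT => /infiniteP/card_leP/injfunPex[v _ vinj].
pose nat_set a : [set: nat] := exist _ a (mem_set (Logic.I : setT a)).
pose u a : 'X_{1..n} := val (v (nat_set a)).
have [phi [phi_lt phi_le]] := coordinatewise_subsequence u (enum 'I_n).
have e : u (phi 0%N) = u (phi 1%N).
  have [_ min1] := set_valP (v (nat_set (phi 1%N))); apply: min1.
    by have [] := set_valP (v (nat_set (phi 0%N))).
  by apply/mnm_lepP => i; apply: phi_le; rewrite ?mem_enum.
have /(congr1 val)/= e' :=
  vinj _ _ (mem_set Logic.I) (mem_set Logic.I) (val_inj e).
by have := phi_lt 0%N 1%N isT; rewrite e' ltnn.
Qed.

Lemma minimal_term_below T t :
  T t -> exists2 m, minimal_terms T m & (m <= t)%MM.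
Proof.
move=> Tt.
have exd : exists d, `[< exists m, [/\ T m, (m <= t)%MM & mdeg m = d] >].
  by exists (mdeg t); apply/asboolP; exists t; rewrite lepm_refl.
case: (ex_minnP exd) => d /asboolP[m [Tm mt <-]] dmin.
exists m => //; split=> // m' Tm' m'm.
have : (mdeg m <= mdeg m')%N.
  by apply: dmin; apply/asboolP; exists m'; rewrite (lepm_trans m'm).
rewrite -{1}(submK m'm) mdegD -{2}[mdeg m']add0n leq_add2r leqn0 mdeg_eq0.
by move=> /eqP e; rewrite -[RHS](submK m'm) e add0m.
Qed.

End Dickson.

(** * Monomial ideals and reduced Groebner bases *)

Section MonomialIdeals.
Context {n : nat} {R : comNzRingType} (M : set 'X_{1..n}).
Local Notation monomial_ideal := (ideal_gen [set 'X_[R, t] | t in M]).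

Lemma monomial_ideal_multiple m t :
  M t -> (t <= m)%MM -> monomial_ideal 'X_[m].
Proof.
move=> Mt tm; rewrite -(submK tm) mpolyXD.
have [_ _] := ideal_gen_ideal [set 'X_[R, t] | t in M]; apply.
by move=> J [_]; apply; exists t.
Qed.

Lemma monomial_ideal_divisor m :
  monomial_ideal 'X_[m] -> exists2 t, M t & (t <= m)%MM.
Proof.
pose J : set {mpoly R[n]} :=
  fun P => forall m, m \in msupp P -> exists2 t, M t & (t <= m)%MM.
suff sJ : monomial_ideal `<=` J by move=> /sJ; apply; rewrite msuppX mem_head.
apply: smallest_sub; last first.
  move=> _ [t Mt <-] m'; rewrite msuppX inE => /eqP->.
  by exists t => //; exact: lepm_refl.
split=> [m'|x y Jx Jy m'|a x Jx m']; first by rewrite msupp0.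
  by move=> /msuppD_le; rewrite mem_cat => /orP[/Jx|/Jy].
move=> /msuppM_le/allpairsP[[m1 m2] [/= _ /Jx[t Mt tm] ->]].
by exists t => //; rewrite (lepm_trans tm) // lem_addl.
Qed.

End MonomialIdeals.

Section LeadingMonomials.
Context {n : nat} {le : rel 'X_{1..n}}.
Hypothesis le_term : term_order le.

Lemma lterm_eq (R : comNzRingType) (P : {mpoly R[n]}) t :
  P@_t != 0 -> (forall m, P@_m != 0 -> le m t) -> lterm le P = t.
Proof.
move=> Pt Pmax; have P0 : P != 0 by apply: contraNneq Pt => ->; rewrite mcoeff0.
have [] := ltermP le_term P0; rewrite mcoeff_msupp => /Pmax le1 /(_ t).
rewrite mcoeff_msupp => /(_ Pt) le2.
by case: le_term => _ anti _ _ _; apply: anti; rewrite le1.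
Qed.

Lemma lterms_mul (R : comNzRingType) (J : set {mpoly R[n]}) m t :
  is_ideal J -> lterms le J t -> lterms le J (m + t)%MM.
Proof.
move=> [_ _ JM] [P [JP /eqP P0] <-]; have [Pt Pmax] := ltermP le_term P0.
have e : lterm le (P * 'X_[m]) = (m + lterm le P)%MM.
  apply: lterm_eq; first by rewrite mcoeffMX -mcoeff_msupp.
  move=> m'; rewrite -mcoeff_msupp (perm_mem (msuppMX _ _)) => /mapP[m'' + ->].
  by move=> /Pmax; case: le_term => _ _ _ _; apply.
exists (P * 'X_[m]) => //; split; first by rewrite mulrC; apply: JM.
move=> P0'; move: Pt.
by rewrite mcoeff_msupp -(mcoeffMX P m) P0' mcoeff0 => /eqP.
Qed.

End LeadingMonomials.

Section ReducedBasis.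
Context {n : nat} {le : rel 'X_{1..n}}.
Hypothesis le_term : term_order le.
Context {k : fieldType} (K : set {mpoly k[n]}).
Hypothesis idK : is_ideal K.
Notation T := (lterms le K).

(** A family of monic elements of [K], one for each leading term [t], whose
    other terms are all standard, yields the reduced Groebner basis when
    restricted to the minimal generators of the initial ideal. *)
Lemma reduced_groebner_basis_minimal (P : 'X_{1..n} -> {mpoly k[n]}) :
  (forall t, T t -> [/\ K (P t), (P t)@_t = 1, lterm le (P t) = t &
     forall m, m \in msupp (P t) -> T m -> m = t]) ->
  reduced_groebner_basis le K [set P t | t in minimal_terms T].
Proof.
move=> hP; have MT t : minimal_terms T t -> T t by case.
have P0 t : T t -> P t <> 0.
  move=> /hP[_ + _ _] => /[swap] ->.
  by rewrite mcoeff0 => /esym/eqP; rewrite oner_eq0.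
split; first split.
- exact/finite_image/finite_minimal_terms.
- by move=> _ [t /MT/hP[? _ _ _] <-].
- apply/seteqP; split; apply: smallest_sub; try exact: ideal_gen_ideal.
    move=> _ [_ [_ [[t /MT Tt <-] _] <-] <-].
    have [_ _ -> _] := hP t Tt.
    by move=> J [_]; apply; exists t.
  move=> _ [t Tt <-]; have [m Mm mt] := minimal_term_below Tt.
  apply: monomial_ideal_multiple mt.
  exists (P m); last by have [] := hP m (MT m Mm).
  by split; [exists m|exact: P0 (MT m Mm)].
- by move=> _ [t /MT/hP[_ Pt lt _] <-]; rewrite lt.
move=> _ m [t Mt <-] mP /monomial_ideal_divisor[_ [_ [[[t' Mt' <-] neq] _] <-]].
have [_ _ -> _] := hP t' (MT t' Mt') => t'm.
have Tm : T m by rewrite -(submK t'm); apply: lterms_mul => //; exact: MT.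
have [_ _ _ /(_ m mP Tm) mt] := hP t (MT t Mt).
case: neq; congr P; case: Mt => _; apply; first exact: MT.
by rewrite -mt.
Qed.

End ReducedBasis.

(** * Leading terms in the fibres *)

Section FiberLeadingTerms.
Context {n : nat} {le : rel 'X_{1..n}}.
Hypothesis le_term : term_order le.

Context {A : comNzRingType}.
Implicit Types (p q : spec A) (Y : set (spec A)) (f : {mpoly A[n]}).

(** The leading term of the image of [f] in the fibre at [p], phrased in [A] so
    that its variation with [p] is visible. *)
Definition leading_at p f t :=
  ~ pideal p f@_t /\ forall m, ~ pideal p f@_m -> le m t.

Lemma coef_residueP p f m :
  reflect (~ pideal p f@_m) ((map_mpoly (to_residue p) f)@_m != 0).
Proof. by rewrite mcoeff_map_mpoly to_residue_eq0; apply: asboolPn. Qed.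

Lemma leading_at_lterm p f t :
  leading_at p f t -> lterm le (map_mpoly (to_residue p) f) = t.
Proof.
move=> [ft fmax]; apply: (lterm_eq le_term); first exact/coef_residueP.
by move=> m /coef_residueP/fmax.
Qed.

Lemma leading_at_lterms (I : set {mpoly A[n]}) p f t :
  I f -> leading_at p f t -> lterms le (fiber_ideal I p) t.
Proof.
move=> If ft; exists (map_mpoly (to_residue p) f); last exact: leading_at_lterm.
split; first exact: fiber_ideal_map.
case: ft => + _ f0; apply.
by apply/asboolP; rewrite -to_residue_eq0 -mcoeff_map_mpoly f0 mcoeff0.
Qed.

Lemma leading_at_exists p f m :
  ~ pideal p f@_m -> exists t, leading_at p f t.
Proof.
move=> pm; set P := map_mpoly (to_residue p) f.
have P0 : P != 0.
  by move/coef_residueP: pm; apply: contraNneq => P0; rewrite -/P P0 mcoeff0.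
have [] := ltermP le_term P0.
rewrite mcoeff_msupp => /coef_residueP Pt Pmax.
exists (lterm le P); split=> // m' /coef_residueP Pm'.
by apply: Pmax; rewrite mcoeff_msupp.
Qed.

(** The only use of homogeneity of [I]: passing to the component of degree
    [mdeg t] leaves finitely many terms that can occur, which makes elimination
    against the leading terms of the fibre a finite process. *)
Lemma lterms_lift (I : set {mpoly A[n]}) p t :
  is_ideal I -> homogeneous I -> lterms le (fiber_ideal I p) t ->
  exists f, [/\ I f, f \is (mdeg t).-homog & leading_at p f t].
Proof.
move=> idI homI [w [Kw /eqP w0] <-]; set t' := lterm le w.
have [u [f [pu If uf]]] := fiber_ideal_lift idI Kw.
have [wt wmax] := ltermP le_term w0.
have fw m : ~ pideal p f@_m <-> m \in msupp w.
  split=> [/coef_residueP|].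
    by rewrite -uf mcoeffZ mcoeff_msupp; apply: contraNneq => ->; rewrite mulr0.
  rewrite mcoeff_msupp => wm; apply/coef_residueP.
  by rewrite -uf mcoeffZ mulf_neq0 // to_residue_eq0; apply/asboolPn.
exists (pihomog mdeg (mdeg t') f).
split; [exact: homI|exact: pihomogP|split].
  by rewrite mcoeff_pihomog eqxx; apply/fw.
move=> m; rewrite mcoeff_pihomog; case: ifP => _; first by move=> /fw/wmax.
by case: (pideal_ideal p).
Qed.

End FiberLeadingTerms.

(** * Elimination against the leading terms of a fibre *)

Section Elimination.
Context {n : nat} {le : rel 'X_{1..n}}.
Hypothesis le_term : term_order le.
Context {A : comNzRingType} (I : set {mpoly A[n]}).
Hypothesis idI : is_ideal I.
Hypothesis homI : homogeneous I.
Implicit Types (p q : spec A) (Y : set (spec A)) (f : {mpoly A[n]}).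
Notation leading_at := (@leading_at n le A).

Lemma is_idealZ (a : A) f : I f -> I (a *: f).
Proof. by rewrite -mul_mpolyC; case: idI => _ _; apply. Qed.

(** Gaussian elimination over [A]. Polynomials of [I] whose images at [p] have
    the leading terms [S] form a triangular system modulo [p]; since its pivots
    are not in [p], cross-multiplication makes it diagonal exactly, over [A],
    with a common diagonal entry [s]. Off the closed set [s = 0] the system
    therefore stays diagonal in all the other fibres. *)
Lemma diagonal_family p d (S : seq 'X_{1..n}) :
  pairwise le S -> uniq S ->
  {in S, forall t, mdeg t = d /\ lterms le (fiber_ideal I p) t} ->
  exists s h, ~ pideal p s /\ {in S, forall t,
    [/\ I (h t), h t \is d.-homog, leading_at p (h t) t &
        {in S, forall t', (h t)@_t' = if t' == t then s else 0}]}.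
Proof.
have idp := pideal_ideal p; have [p0 pD pM] := idp.
have [_ anti tr _ _] := le_term.
(* Terms are added in increasing order, so that the earlier [h t] vanish modulo
   [p] at the new term [t0] and do not disturb its pivot. *)
elim/last_ind: S => [|S t0 IH]; first by exists 1, (fun=> 0); case: (pidealP p).
rewrite pairwise_rcons rcons_uniq => /andP[/allP St0 /IH{}IH] /andP[t0S uS].
move=> SK; have [|s [h [ps hS]]] := IH uS.
  by move=> t St; apply: SK; rewrite mem_rcons inE St orbT.
have [|t0d /(lterms_lift le_term idI homI)] := SK t0.
  by rewrite mem_rcons mem_head.
rewrite t0d => -[f [If fd [ft0 fmax]]].
(* [f] with its coefficients on [S] eliminated. *)
pose f' := s *: f - \sum_(t <- S) f@_t *: h t.
have f'E m : f'@_m = s * f@_m - \sum_(t <- S) f@_t * (h t)@_m.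
  rewrite mcoeffB mcoeffZ raddf_sum /=; congr (_ - _).
  by apply: eq_bigr => t _; rewrite mcoeffZ.
have If' : I f'.
  apply: is_idealB => //; first exact: is_idealZ.
  by apply: is_ideal_sum => // t /hS[Ih _ _ _]; apply: is_idealZ.
have f'd : f' \is d.-homog.
  apply: rpredB; first exact: rpredZ.
  by rewrite big_seq; apply: rpred_sum => t /hS[_ hd _ _]; apply: rpredZ.
have f'S t : t \in S -> f'@_t = 0.
  move=> St; rewrite f'E (bigD1_seq t) //=.
  have [_ _ _ ->//] := hS t St; rewrite eqxx big1_seq ?addr0.
    by rewrite mulrC subrr.
  move=> t' /andP[tt' /hS[_ _ _ ->//]].
  by rewrite eq_sym (negPf tt') mulr0.
have sump m : ~~ le m t0 || (m == t0) ->
    pideal p (\sum_(t <- S) f@_t * (h t)@_m).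
  move=> m0; apply: is_ideal_sum => // t St; apply: pM; apply: contrapT => pm.
  have [_ _ [_ tmax] _] := hS t St; have mt := tmax m pm.
  have tt0 := St0 t St; case/orP: m0; first by rewrite (tr _ _ _ mt tt0).
  move=> /eqP mt0; move: t0S; rewrite -mt0 (anti m t) ?St //.
  by rewrite mt mt0 tt0.
have lead' : leading_at p f' t0.
  split=> [pf'|m pf'].
    apply: (pideal_mulN ps ft0).
    rewrite -(subrK (\sum_(t <- S) f@_t * (h t)@_t0) (s * _)).
    by rewrite -f'E; apply: pD => //; apply: sump; rewrite eqxx orbT.
  apply: contrapT => /negP m0; apply: pf'; rewrite f'E.
  apply: is_idealB => //; last by apply: sump; rewrite m0.
  by apply: pM; apply: contrapT => /fmax; apply/negP.
(* The new pivot; the earlier [h t] are now cleared at [t0]. *)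
pose c := f'@_t0.
have ht0 t : t \in S -> pideal p (h t)@_t0.
  move=> St; apply: contrapT => pm.
  have [_ _ [_ tmax] _] := hS t St; have mt := tmax t0 pm.
  by move: t0S; rewrite -(anti t t0) ?St // mt St0.
have [pc _] := lead'.
exists (s * c).
exists (fun t => if t == t0 then s *: f' else c *: h t - (h t)@_t0 *: f').
split=> [|t]; first exact: pideal_mulN.
rewrite mem_rcons inE; case: eqP => [-> _|/eqP tt0 /= St].
  split; [exact: is_idealZ|exact: rpredZ| |].
    split; rewrite ?mcoeffZ; first exact: pideal_mulN.
    move=> m; rewrite mcoeffZ => pm; apply: (proj2 lead') => pm'; apply: pm.
    exact: pM.
  move=> t'; rewrite mem_rcons inE mcoeffZ; case: eqP => [->//|_ /= /f'S->].
  exact: mulr0.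
have [Ih hd [pt tmax] hz] := hS t St.
split.
- by apply: is_idealB => //; exact: is_idealZ.
- by apply: rpredB; apply: rpredZ.
- have hm m : pideal p (h t)@_m -> pideal p (c *: h t - (h t)@_t0 *: f')@_m.
    rewrite mcoeffB !mcoeffZ => pm; apply: is_idealB => //; first exact: pM.
    by rewrite mulrC; apply: pM; exact: ht0.
  split; last by move=> m pm; apply: tmax => /hm.
  by rewrite mcoeffB !mcoeffZ f'S // mulr0 subr0; apply: pideal_mulN.
- move=> t'; rewrite mem_rcons inE mcoeffB !mcoeffZ.
  case: (eqVneq t' t0) => [-> _|t't0 /= St'].
    by rewrite eq_sym (negPf tt0) -/c mulrC subrr.
  rewrite f'S // mulr0 subr0 hz //; case: ifP => _; last exact: mulr0.
  exact: mulrC.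
Qed.

Lemma degree_enum d (P : set 'X_{1..n}) : exists S : seq 'X_{1..n},
  [/\ pairwise le S, uniq S &
      forall t, t \in S = (mdeg t == d) && `[< P t >]].
Proof.
have [tot _ tr _ _] := le_term.
pose S0 := [seq bmnm m | m <- enum {: 'X_{1..n < d.+1}}].
pose S1 := [seq t <- S0 | (mdeg t == d) && `[< P t >]].
exists (sort le S1); split.
- by rewrite -(sorted_pairwise tr); apply: sort_sorted.
- rewrite sort_uniq filter_uniq // map_inj_uniq ?enum_uniq //.
  exact: val_inj.
- move=> t; rewrite mem_sort mem_filter; case: eqP => //= td.
  case: `[< _ >] => //=; apply/mapP.
  have td' : (mdeg t < d.+1)%N by rewrite td.
  by exists (BMultinom td') => //; rewrite mem_enum.
Qed.

(** Dividing by the coefficient at [t] turns [f] into the element of the reduced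
    Groebner basis with leading term [t], when [t] is a minimal generator of the
    initial ideal [T]. The definition does not mention any prime: this is what
    makes one numerator serve a whole neighbourhood. *)
Definition reduced_numerator (T : set 'X_{1..n}) f t :=
  [/\ I f, f \is (mdeg t).-homog & forall m, T m -> m != t -> f@_m = 0].

Lemma reduced_numerator_exists p t (T := lterms le (fiber_ideal I p)) :
  T t -> exists f, reduced_numerator T f t /\ leading_at p f t.
Proof.
move=> Tt; have [S [Sle Su ST]] := degree_enum (mdeg t) T.
have [|s [h [ps hS]]] := diagonal_family (p := p) (d := mdeg t) Sle Su.
  by move=> t'; rewrite ST => /andP[/eqP ? /asboolP].
have [|Ih hd lead hz] := hS t; first by rewrite ST eqxx; apply/asboolP.
exists (h t); split=> //; split=> // m Tm mt.
have [md|md] := eqVneq (mdeg m) (mdeg t); last exact: (dhomog_nemf_coeff hd).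
by rewrite hz ?(negPf mt) // ST md eqxx; apply/asboolP.
Qed.

Section Stratum.
Context (Y : set (spec A)) (T : set 'X_{1..n}).
Hypothesis YT : forall p, Y p -> lterms le (fiber_ideal I p) = T.

(** At a point of [Y] a nonzero image of [f] would have a leading term in the
    fibre ideal outside [T]. *)
Lemma vanishing_coeff f :
  I f -> (forall m, T m -> f@_m = 0) -> forall m, vanishing Y f@_m.
Proof.
move=> If f0 m p Yp; apply: contrapT => /(leading_at_exists le_term)[t ft].
have [] := ft; rewrite f0; first by case: (pideal_ideal p).
by rewrite -(YT Yp); apply: leading_at_lterms ft.
Qed.

(** Among the terms of [T], only [t] occurs in [f], so no other term can be the
    leading one. *)
Lemma reduced_numerator_leading p f t :
  Y p -> reduced_numerator T f t -> ~ pideal p f@_t -> leading_at p f t.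
Proof.
move=> Yp [If _ f0] pt; have [t' ft'] := leading_at_exists le_term pt.
have [<-//|tt'] := eqVneq t' t.
have [] := ft'; rewrite f0 //; first by case: (pideal_ideal p).
by rewrite -(YT Yp); apply: leading_at_lterms ft'.
Qed.

(** For [m] beyond [t], the product of the coefficients at [t] and at [m]
    vanishes on [Y], hence on its closure. *)
Lemma reduced_numerator_closure p f t :
  closure Y p -> reduced_numerator T f t -> ~ pideal p f@_t -> leading_at p f t.
Proof.
rewrite closure_vanishing => Yp ft pt; split=> // m pm.
apply: contrapT => tm; apply: (pideal_mulN pt pm); apply: Yp => q Yq.
have [_ _ qM] := pideal_ideal q.
have [qt|qt] := EM (pideal q f@_t); first by rewrite mulrC; apply: qM.
apply: qM; apply: contrapT => qm.
by have [_ /(_ m qm)] := reduced_numerator_leading Yq ft qt.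
Qed.

(** The dimension of a fibre ideal in a given degree can only drop under
    specialization. Concretely, an extra leading term [t] at [p] would, after
    elimination of all of [T] in its degree, give an [h] in [I] without terms in
    [T] and with coefficient outside [p] at [t]; but such an [h] vanishes on
    [Y], hence at [p]. *)
Lemma lterms_closure_sub p : closure Y p ->
  T `<=` lterms le (fiber_ideal I p) -> lterms le (fiber_ideal I p) = T.
Proof.
move=> Yp TK; apply/seteqP; split=> // t Kt; apply: contrapT => Tt.
set T' : set 'X_{1..n} := fun m => T m \/ m = t.
have [S [Sle Su ST]] := degree_enum (mdeg t) T'.
have [|s [h [ps hS]]] := diagonal_family (p := p) (d := mdeg t) Sle Su.
  by move=> t'; rewrite ST => /andP[/eqP ? /asboolP[/TK|->]].
have [|Ih hd _ hz] := hS t; first by rewrite ST eqxx; apply/asboolP; right.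
have tS : t \in S by rewrite ST eqxx; apply/asboolP; right.
have hT m : T m -> (h t)@_m = 0.
  move=> Tm; have [md|md] := eqVneq (mdeg m) (mdeg t).
    2: exact: (dhomog_nemf_coeff hd).
  rewrite hz; last by rewrite ST md eqxx; apply/asboolP; left.
  by case: eqP => // mt; case: Tt; rewrite -mt.
apply: ps; have := hz t tS; rewrite eqxx => <-.
by move: Yp; rewrite closure_vanishing; apply; apply: vanishing_coeff.
Qed.

End Stratum.
End Elimination.

(** * Fractions in the stalks *)

(** Stalks are used below only as rings in which the relevant denominators are
    invertible, so the computations are done over an abstract ring [R]. *)
Section Fractions.
Context {A R : comNzRingType} {n : nat} (phi : {rmorphism A -> R}).
Implicit Types f : {mpoly A[n]}.

Lemma fraction_eq s s' (i i' : R) f f' :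
  phi s * i = 1 -> phi s' * i' = 1 ->
  (forall m, phi (s' * f@_m - s * f'@_m) = 0) ->
  i *: map_mpoly phi f = i' *: map_mpoly phi f'.
Proof.
move=> si si' ff'; apply/mpolyP => m; rewrite !mcoeffZ !mcoeff_map_mpoly.
have /eqP := ff' m; rewrite rmorphB !rmorphM subr_eq0 => /eqP e.
have -> : i * phi f@_m = i * i' * (phi s' * phi f@_m).
  by rewrite -[LHS]mulr1 -si'; ring.
by rewrite e -[RHS]mul1r -si; ring.
Qed.

Lemma map_fraction (K : fieldType) (psi : {rmorphism R -> K})
    (chi : {rmorphism A -> K}) s (i : R) f :
  (forall a, psi (phi a) = chi a) -> phi s * i = 1 ->
  map_mpoly psi (i *: map_mpoly phi f) = (chi s)^-1 *: map_mpoly chi f.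
Proof.
move=> pp si; apply/mpolyP => m.
rewrite mcoeffZ !mcoeff_map_mpoly mcoeffZ mcoeff_map_mpoly.
(* Restated to put the operations of [R] and [K] in their standard form. *)
suff key : psi (i * phi f@_m) = (chi s)^-1 * chi f@_m by exact: key.
rewrite rmorphM pp; congr (_ * _).
have e : chi s * psi i = 1 by rewrite -pp -rmorphM si rmorph1.
have s0 : chi s != 0.
  by apply: contra_eq_neq e => ->; rewrite mul0r eq_sym oner_neq0.
by apply: (mulfI s0); rewrite e divff.
Qed.

End Fractions.

Section Germs.
Context {A : comNzRingType} {n : nat}.
Implicit Types (Y : set (spec A)) (f : {mpoly A[n]}).

Definition fraction_at Y (q : Y) f (s : A) : {mpoly (stalk q)[n]} :=
  loc_frac _ 1 s *: map_mpoly (@loc_of A _ : A -> stalk q) f.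

(** Functions on the reduced subscheme [Y] are determined by their values. *)
Lemma fraction_at_eq Y (q : Y) f f' s s' :
  ~ pideal (val q) s -> ~ pideal (val q) s' ->
  (forall m, vanishing Y (s' *: f - s *: f')@_m) ->
  fraction_at q f s = fraction_at q f' s'.
Proof.
move=> qs qs' ff'.
apply: (@fraction_eq A (stalk q) n (@loc_of A _) s s').
- by rewrite loc_frac_mul ?rmorph1.
- by rewrite loc_frac_mul ?rmorph1.
- move=> m; apply: loc_of_eq0.
  by have := ff' m; rewrite mcoeffB !mcoeffZ.
Qed.

Lemma map_fraction_at Y (p : Y) f s :
  ~ pideal (val p) s ->
  map_mpoly (@loc_residue A _ : stalk p -> residue (val p)) (fraction_at p f s)
  = (to_residue (val p) s)^-1 *: map_mpoly (to_residue (val p)) f.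
Proof.
move=> ps.
apply: (@map_fraction A (stalk p) n (@loc_of A _) (residue (val p))
  (@loc_residue A _) (to_residue (val p))).
  move=> a.
  exact:
    (loc_residue_of (LocData (vanishing_ideal Y) (@vanishing_sub A Y p)) a).
by rewrite loc_frac_mul ?rmorph1.
Qed.

End Germs.

(** * The sections of the reduced Groebner bases *)

Section Sections.
Context {n : nat} {le : rel 'X_{1..n}}.
Hypothesis le_term : term_order le.
Context {A : comNzRingType} (I : set {mpoly A[n]}).
Hypothesis idI : is_ideal I.
Context (Y : set (spec A)) (T : set 'X_{1..n}).
Hypothesis YT : forall p, Y p -> lterms le (fiber_ideal I p) = T.
Implicit Types (p q : spec A) (f : {mpoly A[n]}).
Local Notation numerator := (reduced_numerator I T).

Lemma numerator_normalized p f t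
    (P := (to_residue p f@_t)^-1 *: map_mpoly (to_residue p) f) :
  Y p -> numerator f t -> ~ pideal p f@_t ->
  [/\ fiber_ideal I p P, P@_t = 1, lterm le P = t &
     forall m, m \in msupp P -> T m -> m = t].
Proof.
move=> Yp ft pt; have [If _ fT] := ft.
have s0 : to_residue p f@_t != 0 by rewrite to_residue_eq0; apply/asboolPn.
have PE m : P@_m = (to_residue p f@_t)^-1 * to_residue p f@_m.
  by rewrite mcoeffZ mcoeff_map_mpoly.
have Pm m : P@_m != 0 -> ~ pideal p f@_m.
  move=> + pm; rewrite PE.
  have /eqP -> : to_residue p f@_m == 0.
    by rewrite to_residue_eq0; apply/asboolP.
  by rewrite mulr0 eqxx.
have P1 : P@_t = 1 by rewrite PE mulVf.
split=> //.
- rewrite /P -mul_mpolyC.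
  have [_ _ KM] := ideal_gen_ideal [set map_mpoly (to_residue p) f | f in I].
  by apply: KM; exact: fiber_ideal_map.
- apply: lterm_eq => //; first by rewrite P1 oner_neq0.
  have [_ fmax] := reduced_numerator_leading le_term YT Yp ft pt.
  by move=> m /Pm/fmax.
- move=> m; rewrite mcoeff_msupp => /Pm pm Tm; apply: contrapT => /eqP mt.
  by apply: pm; rewrite fT //; case: (pideal_ideal p).
Qed.

(** The reduced Groebner basis is unique, so two numerators for [t] give the
    same function wherever both are defined: in the cross difference every term
    of [T] cancels. *)
Lemma numerators_agree f f' t : numerator f t -> numerator f' t ->
  forall m, vanishing Y (f'@_t *: f - f@_t *: f')@_m.
Proof.
move=> [If _ f0] [If' _ f'0]; apply: (vanishing_coeff le_term YT).
  by apply: is_idealB => //; exact: is_idealZ.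
move=> m Tm; rewrite mcoeffB !mcoeffZ; have [->|mt] := eqVneq m t.
  by rewrite mulrC subrr.
by rewrite (f0 m Tm mt) (f'0 m Tm mt) !mulr0 subrr.
Qed.

(** The germ at each point is given by a numerator chosen at that point;
    coherence of these unrelated choices comes from [numerators_agree]. *)
Definition reduced_section (num : spec A -> {mpoly A[n]}) t (p : Y) :
    {mpoly (stalk p)[n]} :=
  fraction_at p (num (val p)) (num (val p))@_t.

Lemma reduced_section_ideal num t :
  (forall p, Y p -> numerator (num p) t /\ ~ pideal p (num p)@_t) ->
  ideal_section I (reduced_section num t).
Proof.
move=> hnum p; have Yp := set_valP p.
have [fp pp] := hnum _ Yp; set f := num (val p) in fp pp.
exists [set q | ~ pideal q f@_t]; split=> //; first exact: open_nonvanishing.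
exists f; first by case: fp.
exists f@_t => q qf; split; first exact: qf.
have [fq qq] := hnum _ (set_valP q).
have key : reduced_section num t q = fraction_at q f f@_t.
  apply: fraction_at_eq; [exact: qq|exact: qf|exact: numerators_agree].
exact: key.
Qed.

Lemma section_at_reduced num t (p : Y) : ~ pideal (val p) (num (val p))@_t ->
  section_at (reduced_section num t) p =
  (to_residue (val p) (num (val p))@_t)^-1 *:
    map_mpoly (to_residue (val p)) (num (val p)).
Proof. exact: map_fraction_at. Qed.

Lemma open_minimal_numerators : open [set q : spec A |
  forall t, minimal_terms T t -> exists2 f, numerator f t & ~ pideal q f@_t].
Proof.
rewrite -closedC.
have -> : ~` [set q : spec A | forall t, minimal_terms T t ->
    exists2 f, numerator f t & ~ pideal q f@_t] =
  \bigcup_(t in minimal_terms T)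
    ~` [set q | exists2 f, numerator f t & ~ pideal q f@_t].
  apply/seteqP; split=> q /=.
    by move=> /existsNP[t /not_implyP[Mt qt]]; exists t.
  by move=> [t Mt qt] /(_ t Mt).
apply: closed_bigcup; first exact: finite_minimal_terms.
move=> t _; rewrite closedC.
have -> : [set q | exists2 f, numerator f t & ~ pideal q f@_t] =
  \bigcup_(f in [set f | numerator f t]) [set q | ~ pideal q f@_t].
  by apply/seteqP; split=> q /= [f ft qf]; exists f.
by apply: bigcup_open => f _; exact: open_nonvanishing.
Qed.

End Sections.

Theorem theorem12 (A : comNzRingType) (n : nat) (le : rel 'X_{1..n})
    (I : set {mpoly A[n]}) (L : set (spec A)) :
  noetherian A -> reduced A -> term_order le ->
  is_ideal I -> homogeneous I -> locally_closed L ->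
  forall Y : set (spec A), eq_classes L (lt_equiv le I) Y ->
    parametric le I Y.
Proof.
move=> _ _ le_term idI homI [U [Z [Uo Zc LUZ]]] Y [p0 Lp0 YE].
set T := lterms le (fiber_ideal I p0).
have YT p : Y p -> lterms le (fiber_ideal I p) = T.
  by rewrite -YE => -[_ e]; exact: esym e.
have idK p : is_ideal (fiber_ideal I p) by exact: ideal_gen_ideal.
have /choice[num hnum] (tp : 'X_{1..n} * spec A) : exists f, T tp.1 ->
    Y tp.2 -> reduced_numerator I T f tp.1 /\ ~ pideal tp.2 f@_tp.1.
  case: tp => t p /=; have [Tt|?] := EM (T t); last by exists 0.
  have [Yp|?] := EM (Y p); last by exists 0.
  have [|f [ft [pt _]]] :=
    reduced_numerator_exists le_term idI homI (p := p) (t := t).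
    by rewrite YT.
  by exists f; rewrite -(YT _ Yp).
pose N t p := num (t, p).
have hN t p : T t -> Y p -> reduced_numerator I T (N t p) t /\
    ~ pideal p (N t p)@_t by exact: (hnum (t, p)).
split.
  (* [Y] is open in its closure: near a point of [Y] the numerators of the
     finitely many minimal terms keep their leading terms, so the initial ideal
     on the closure contains [T], and cannot be larger. *)
  exists (U `&` [set q | forall t, minimal_terms T t ->
    exists2 f, reduced_numerator I T f t & ~ pideal q f@_t]), (closure Y).
  split; [exact/openI/open_minimal_numerators|exact: closed_closure|].
  apply/seteqP; split=> q.
    move=> Yq; split; last exact: subset_closure.
    split; first by move: Yq; rewrite -YE LUZ => -[[]].
    by move=> t [Tt _]; have [] := hN t q Tt Yq; exists (N t q).
  move=> [[Uq qnum] clq].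
  have Lq : L q.
    rewrite LUZ; split=> //; rewrite ((closure_id Z).1 Zc).
    by apply: closure_subset clq => r; rewrite -YE LUZ => -[[]].
  rewrite -YE; split=> //; symmetry.
  apply: (lterms_closure_sub le_term idI homI YT clq) => t Tt.
  have [m Mm mt] := minimal_term_below Tt.
  have [f fm qf] := qnum m Mm; rewrite -(submK mt); apply: lterms_mul => //.
  apply: (leading_at_lterms le_term (f := f)); first by case: fm.
  exact: (reduced_numerator_closure le_term YT).
exists [set reduced_section (N t) t | t in minimal_terms T]; split.
- exact/finite_image/finite_minimal_terms.
- move=> _ [t [Tt _] <-]; apply: (reduced_section_ideal le_term idI YT).
  by move=> p; apply: hN.
- move=> p; have Yp := set_valP p.
  rewrite image_comp.
  have := reduced_groebner_basis_minimal le_term (idK (val p)).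
  rewrite YT //; apply=> t Tt /=; have [ft pt] := hN t _ Tt Yp.
  rewrite section_at_reduced //.
  exact: (numerator_normalized le_term YT).
- move=> _ [t [Tt _] <-] p q.
  suff lt (r : Y) : lterm le (section_at (reduced_section (N t) t) r) = t.
    by rewrite !lt.
  have Yr := set_valP r; have [fr pr] := hN t _ Tt Yr.
  rewrite section_at_reduced //.
  by have [] := numerator_normalized le_term YT Yr fr pr.
Qed.
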